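(* Let $A,B\in\mathbb{R}^{n\times n}$ be symmetric positive semi-definite matrices with $\mathrm{Ker}(A)=\mathrm{Ker}(B)=W$, and assume there are constants $\alpha,\beta>0$ such that $\alpha\langle Bu,u\rangle\le\langle Au,u\rangle\le\beta\langle Bu,u\rangle$ for all $u\in\mathbb{R}^n$. Let $f:\mathbb{R}\to\mathbb{R}$ be $\mathcal{C}^1$ with $|f'|_\infty\le L$, let $\epsilon>0$, $\tau\ge0$, $\Delta t>0$, and consider the RSS-IMEX scheme for the Allen–Cahn equation: given $u^{(0)}\in\mathbb{R}^n$, for $k\ge0$, $$(Id+\tau\Delta t\,B)(u^{(k+1)}-u^{(k)})=-\Delta t\left(Au^{(k)}+\frac{1}{\epsilon^2}f(u^{(k)})\right).$$ Let $\lambda_{\min}(A)$ denote the smallest strictly positive eigenvalue of $A$. If $W=\{0\}$, the following stability conditions hold: (1) If $\tau\ge\frac{\beta}{2}$: (a) if $\left(\frac{\tau}{\beta}-\frac12\right)\lambda_{\min}(A)-\frac{L}{2\epsilon^2}\ge0$, the scheme is unconditionally stable (stable for all $\Delta t>0$); (b) if $\left(\frac{\tau}{\beta}-\frac12\right)\lambda_{\min}(A)-\frac{L}{2\epsilon^2}<0$, the scheme is stable for $$0<\Delta t<\frac{1}{\frac{L}{2\epsilon^2}-\left(\frac{\tau}{\beta}-\frac12\right)\lambda_{\min}(A)}.$$ (2) If $\tau<\frac{\beta}{2}$, the scheme is stable for $$0<\Delta t<\frac{1}{\frac{L}{2\epsilon^2}-\left(\frac{\tau}{\beta}-\frac12\right)\rho(A)}.$$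 If $W\ne\{0\}$, the stability conditions (1)–(2) above apply whenever one assumes in addition that $0<\Delta t<\frac{2\epsilon^2}{L}$.
   Context: $\langle\cdot,\cdot\rangle$ is the Euclidean scalar product on $\mathbb{R}^n$, $\rho(A)$ is the spectral radius of $A$, and $f$ and $F$ are applied componentwise to vectors. $F$ is the primitive of $f$ with $F(0)=0$, and ${\bf 1}=(1,\dots,1)$. The energy is $E(u)=\frac12\langle Au,u\rangle+\frac{1}{\epsilon^2}\langle F(u),{\bf 1}\rangle$. ''Stable'' means energy diminishing: $E(u^{(k+1)})\le E(u^{(k)})$ for all $k\ge0$ (for every initial vector $u^{(0)}$). *)

(* Defs.v *)
From HB Require Import structures.
From mathcomp Require Import all_boot all_order all_algebra.
From mathcomp Require Import complex.
From mathcomp Require Import all_classical all_reals all_analysis.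

Set Implicit Arguments.
Unset Strict Implicit.
Unset Printing Implicit Defensive.

Import Order.TTheory GRing.Theory Num.Theory.
Import numFieldNormedType.Exports.

Local Open Scope classical_set_scope.
Local Open Scope ring_scope.

Definition dotcv (R : realType) (n : nat) (u v : 'cV[R]_n) : R :=
  \sum_(i < n) u i 0 * v i 0.

Definition symmetric_psd (R : realType) (n : nat) (A : 'M[R]_n) : Prop :=
  A^T = A /\ forall u : 'cV[R]_n, 0 <= dotcv (A *m u) u.

(* Kernel for the action on column vectors ([kermx] is for row vectors). *)
Definition Ker (R : realType) (n : nat) (A : 'M[R]_n) : set 'cV[R]_n :=
  [set u | A *m u = 0].

(* The eigenvalues are the complex ones, as A is not assumed symmetric here. *)
Definition spectral_radius (R : realType) (n : nat) (A : 'M[R]_n) : R :=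
  sup [set Normc.normc z |
        z in [set z : R[i] | eigenvalue (map_mx (real_complex R) A) z]].

Definition smallest_pos_eigenvalue (R : realType) (n : nat) (A : 'M[R]_n)
    (l : R) : Prop :=
  [/\ eigenvalue A l, 0 < l
    & forall m : R, eigenvalue A m -> 0 < m -> l <= m].

(* There is at most one smallest positive eigenvalue.  If there is none
   (for a symmetric positive semi-definite A, only when A = 0), the value
   is 0 by convention. *)
Definition lambda_min (R : realType) (n : nat) (A : 'M[R]_n) : R :=
  xget 0 [set l | smallest_pos_eigenvalue A l].

Definition C1 (R : realType) (f : R -> R) : Prop :=
  (forall x : R, derivable f x 1) /\ continuous (derive1 f).

Definition primitive0 (R : realType) (f F : R -> R) : Prop :=
  F 0 = 0 /\ forall x : R, is_derive x 1 F (f x).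

Definition energy (R : realType) (n : nat) (A : 'M[R]_n) (F : R -> R)
    (eps : R) (u : 'cV[R]_n) : R :=
  2^-1 * dotcv (A *m u) u
  + (eps ^+ 2)^-1 * dotcv (map_mx F u) (const_mx 1).

Definition rss_imex (R : realType) (n : nat) (A B : 'M[R]_n) (f : R -> R)
    (eps tau dt : R) (u : nat -> 'cV[R]_n) : Prop :=
  forall k : nat,
    (1%:M + (tau * dt) *: B) *m (u k.+1 - u k) =
    - dt *: (A *m u k + (eps ^+ 2)^-1 *: map_mx f (u k)).

(* The initial vector u 0 is arbitrary. *)
Definition stable (R : realType) (n : nat) (A B : 'M[R]_n) (f F : R -> R)
    (eps tau dt : R) : Prop :=
  forall u : nat -> 'cV[R]_n, rss_imex A B f eps tau dt u ->
  forall k : nat, energy A F eps (u k.+1) <= energy A F eps (u k).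

(* Main.v *)
Require Import Defs.
From HB Require Import structures.
From mathcomp Require Import all_boot all_order all_algebra.
From mathcomp Require Import complex.
From mathcomp Require Import all_classical all_reals all_analysis.
From mathcomp Require Import lra.

Set Implicit Arguments.
Unset Strict Implicit.
Unset Printing Implicit Defensive.

(** One step of the scheme moves [u] to [u + d].  Pairing the equation of the
    step with [d] expresses [<A u + f(u) / eps^2, d>], the first-order variation
    of the energy, as [- |d|^2 / dt - tau <B d, d>].  The energy exceeds its
    first-order expansion by [<A d, d> / 2] and by a remainder which is at most
    [L / (2 eps^2) |d|^2], since the derivative of [f] is bounded by [L]
    ([primitive_taylor_le]).  As [<A d, d> <= beta <B d, d>], this gives
    ([implicit_step_energy_le])
    [[
      E (u + d) - E u <= (1/2 - tau/beta) <A d, d> + (L/(2 eps^2) - 1/dt) |d|^2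
    ]]
    so that the scheme is stable as soon as this quadratic form in [d] is
    nonpositive.

    When [tau < beta / 2] the first coefficient is positive and [<A d, d>] is
    bounded above by [rho(A) |d|^2]; when [tau >= beta / 2] it is nonpositive
    and, if [A] is injective, [<A d, d>] is at least [lambda_min(A) |d|^2].
    Both bounds follow from the fact that the minimum of the Rayleigh quotient
    of a symmetric matrix is an eigenvalue ([rayleigh_min_eigenvalue]).  If [A]
    has a kernel, the lower bound may fail on it, but [dt < 2 eps^2 / L] makes the
    second coefficient negative as well, so that for [tau >= beta / 2] both
    terms are nonpositive. *)

Import Order.TTheory GRing.Theory Num.Theory.
Import numFieldNormedType.Exports.

Local Open Scope classical_set_scope.
Local Open Scope ring_scope.

(** * The Euclidean scalar product *)

Lemma dotcvE (R : realType) n (u v : 'cV[R]_n) : dotcv u v = (u^T *m v) 0 0.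
Proof. by rewrite mxE; apply: eq_bigr => i _; rewrite mxE. Qed.

Lemma dotcvC (R : realType) n (u v : 'cV[R]_n) : dotcv u v = dotcv v u.
Proof. by apply: eq_bigr => i _; rewrite mulrC. Qed.

Lemma dotcvDl (R : realType) n (u v w : 'cV[R]_n) :
  dotcv (u + v) w = dotcv u w + dotcv v w.
Proof. by rewrite -big_split; apply: eq_bigr => i _; rewrite mxE mulrDl. Qed.

Lemma dotcvZl (R : realType) n (a : R) (u v : 'cV[R]_n) :
  dotcv (a *: u) v = a * dotcv u v.
Proof. by rewrite mulr_sumr; apply: eq_bigr => i _; rewrite mxE mulrA. Qed.

Lemma dotcvDr (R : realType) n (u v w : 'cV[R]_n) :
  dotcv u (v + w) = dotcv u v + dotcv u w.
Proof. by rewrite dotcvC dotcvDl !(dotcvC u). Qed.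

Lemma dotcvZr (R : realType) n (a : R) (u v : 'cV[R]_n) :
  dotcv u (a *: v) = a * dotcv u v.
Proof. by rewrite dotcvC dotcvZl (dotcvC u). Qed.

Lemma dotcv_ge0 (R : realType) n (u : 'cV[R]_n) : 0 <= dotcv u u.
Proof. by apply: sumr_ge0 => i _; rewrite -expr2 sqr_ge0. Qed.

Lemma dotcv_gt0 (R : realType) n (u : 'cV[R]_n) : u != 0 -> 0 < dotcv u u.
Proof.
move=> u0; rewrite lt_def dotcv_ge0 andbT; apply: contra u0 => /eqP uu0.
apply/eqP/matrixP => i j; rewrite ord1 mxE; apply/eqP.
rewrite -sqrf_eq0 expr2; apply/eqP; apply: psumr_eq0P uu0 i isT => k _.
by rewrite -expr2 sqr_ge0.
Qed.

Lemma dotcv_mulmx_sym (R : realType) n (A : 'M[R]_n) (u v : 'cV[R]_n) :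
  A^T = A -> dotcv (A *m u) v = dotcv u (A *m v).
Proof. by move=> symA; rewrite !dotcvE trmx_mul symA mulmxA. Qed.

Lemma le_sqr_dotcv (R : realType) n (u : 'cV[R]_n) i :
  u i 0 ^+ 2 <= dotcv u u.
Proof.
rewrite /dotcv (bigD1 i) //= -expr2 lerDl; apply: sumr_ge0 => j _.
by rewrite -expr2 sqr_ge0.
Qed.

(** Provides both a starting point for the supremum defining the minimal
    Rayleigh quotient and the coercivity constant of an invertible matrix. *)
Lemma dotcv_mulmx_bounded (R : realType) n (A : 'M[R]_n) :
  exists2 K : R, 0 < K &
    forall u : 'cV[R]_n, `|dotcv (A *m u) u| <= K * dotcv u u.
Proof.
exists (1 + \sum_i \sum_j `|A i j|) => [|u].
  rewrite ltr_pwDl //; apply: sumr_ge0 => i _.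
  by apply: sumr_ge0.
rewrite mulrDl mul1r.
apply: (@le_trans _ _ ((\sum_i \sum_j `|A i j|) * dotcv u u)); last first.
  by rewrite lerDr dotcv_ge0.
rewrite {1}/dotcv mulr_suml; apply: (le_trans (ler_norm_sum _ _ _)).
apply: ler_sum => i _; rewrite mxE !mulr_suml.
apply: (le_trans (ler_norm_sum _ _ _)); apply: ler_sum => j _.
rewrite -mulrA normrM ler_wpM2l //.
have := le_sqr_dotcv u i; have := le_sqr_dotcv u j => hi hj.
rewrite ler_norml; apply/andP; split.
  by have := sqr_ge0 (u i 0 + u j 0); nra.
by have := sqr_ge0 (u i 0 - u j 0); nra.
Qed.

(** * Extremal eigenvalues of a symmetric matrix *)

(** If [K] bounds the quadratic form of [A^-1], nonnegativity of the quadratic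
    form of [A] at [u - K^-1 A^-1 u] reads
    [<A u, u> >= 2 K^-1 |u|^2 - K^-2 <A^-1 u, u> >= K^-1 |u|^2]; this is the
    Cauchy-Schwarz inequality of [A] with the optimization already done. *)
Lemma psd_unitmx_coercive (R : realType) n (A : 'M[R]_n) :
  symmetric_psd A -> A \in unitmx ->
  exists2 c : R, 0 < c &
    forall u : 'cV[R]_n, c * dotcv u u <= dotcv (A *m u) u.
Proof.
move=> [symA psdA] unitA.
have [K K0 leK] := dotcv_mulmx_bounded (invmx A).
exists K^-1 => [|u]; first by rewrite invr_gt0.
set y := invmx A *m u.
have Ay : A *m y = u by rewrite /y mulKVmx.
have := psdA (u - K^-1 *: y).
rewrite -scaleNr mulmxDr -scalemxAr Ay dotcvDl !dotcvDr !dotcvZl !dotcvZr.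
rewrite (dotcv_mulmx_sym u y symA) Ay (dotcvC u y).
have := leK u; rewrite -/y => /(le_trans (ler_norm _)) yK.
have : K^-1 * (K^-1 * dotcv y u) <= K^-1 * dotcv u u.
  by rewrite ler_pM2l ?invr_gt0 // -ler_pdivlMl ?invr_gt0 // invrK.
set a := dotcv u u; set b := dotcv y u; set c := dotcv _ _; nra.
Qed.

(** [eigenvalue] is defined with row vectors; symmetry passes to columns. *)
Lemma eigenvalue_cV (R : realType) n (A : 'M[R]_n) (l : R) :
  A^T = A -> eigenvalue A l -> exists2 v : 'cV[R]_n, A *m v = l *: v & v != 0.
Proof.
move=> symA /eigenvalueP[v vA v0]; exists v^T; last first.
  by rewrite -trmx0 (inj_eq trmx_inj).
by rewrite -{1}symA -trmx_mul vA linearZ.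
Qed.

(** Let [m] be the largest number with [m |u|^2 <= <A u, u>] for all [u].  Then
    [A - m] is positive semi-definite, and it is not invertible: otherwise it
    would be coercive, and its coercivity constant could be added to [m].  This
    replaces both the compactness of the sphere and diagonalization. *)
Lemma rayleigh_min_eigenvalue (R : realType) n (A : 'M[R]_n) :
  (0 < n)%N -> A^T = A ->
  exists2 m : R, eigenvalue A m &
    forall u : 'cV[R]_n, m * dotcv u u <= dotcv (A *m u) u.
Proof.
move=> n0 symA.
have [K _ leK] := dotcv_mulmx_bounded A.
pose S := [set c : R | forall u : 'cV[R]_n, c * dotcv u u <= dotcv (A *m u) u].
have SK : S (- K).
  by move=> u; have := leK u; rewrite ler_norml mulNr => /andP[].
pose e : 'cV[R]_n := const_mx 1.
have e0 : 0 < dotcv e e.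
  apply: dotcv_gt0; apply/eqP => /matrixP /(_ (Ordinal n0) 0).
  by rewrite !mxE => /eqP; rewrite oner_eq0.
have ubS : has_ubound S.
  exists (dotcv (A *m e) e / dotcv e e) => c Sc.
  by rewrite ler_pdivlMr.
have Ssup : S (sup S).
  move=> u; have [->|u0] := eqVneq u 0.
    by rewrite mulmx0 -(scale0r (0 : 'cV[R]_n)) !dotcvZl !mul0r mulr0.
  rewrite -ler_pdivlMr ?dotcv_gt0 //; apply: ge_sup; first by exists (- K).
  by move=> c Sc; rewrite ler_pdivlMr ?dotcv_gt0.
exists (sup S) => //.
rewrite /eigenvalue /eigenspace kermx_eq0 row_free_unit; apply/negP => unitAm.
have quadE u : dotcv ((A - (sup S)%:M) *m u) u
               = dotcv (A *m u) u - sup S * dotcv u u.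
  by rewrite mulmxBl mul_scalar_mx -scaleNr dotcvDl dotcvZl mulNr.
have [|//|c c0 cle] := @psd_unitmx_coercive _ _ (A - (sup S)%:M).
  split=> [|u]; first by rewrite linearB /= symA tr_scalar_mx.
  by rewrite quadE subr_ge0; apply: Ssup.
have : S (sup S + c) by move=> u; have := cle u; rewrite quadE mulrDl; lra.
by move=> /(ub_le_sup ubS); lra.
Qed.

(** Injectivity excludes the eigenvalue 0, so the minimal Rayleigh quotient is a
    positive eigenvalue, hence at least [lambda_min A].  If there is no smallest
    positive eigenvalue, [lambda_min A] is 0 and semi-definiteness suffices. *)
Lemma lambda_min_le_rayleigh (R : realType) n (A : 'M[R]_n) :
  symmetric_psd A -> Ker A = [set 0] ->
  forall u : 'cV[R]_n, lambda_min A * dotcv u u <= dotcv (A *m u) u.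
Proof.
move=> [symA psdA] kerA u; rewrite /lambda_min.
case: xgetP => [l _ [eigl l0 minl]|_]; last by rewrite mul0r.
have n0 : (0 < n)%N.
  have [v _] := eigenvalueP eigl; case: n v {A symA psdA kerA u eigl minl} => //.
  by move=> v; rewrite [v]thinmx0 eqxx.
have [m eigm mle] := rayleigh_min_eigenvalue n0 symA.
apply: le_trans (mle u); rewrite ler_wpM2r ?dotcv_ge0 // minl //.
have [v Av v0] := eigenvalue_cV symA eigm.
have vv := dotcv_gt0 v0.
rewrite lt_def; apply/andP; split; last first.
  by have := psdA v; rewrite Av dotcvZl pmulr_lge0.
apply: contra v0 => /eqP m0.
by have : Ker A v; [rewrite /Ker /= Av m0 scale0r | rewrite kerA => ->].
Qed.

(** A supremum says something about its set only if the latter is bounded: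
    the complex eigenvalues are the finitely many roots of the characteristic
    polynomial. *)
Lemma eigenvalue_le_spectral_radius (R : realType) n (A : 'M[R]_n) (l : R) :
  eigenvalue A l -> `|l| <= spectral_radius A.
Proof.
move=> eigl; apply: ub_le_sup; last first.
  exists l%:C%C; first by rewrite /= eigenvalue_map.
  by rewrite /Normc.normc /= expr0n addr0 sqrtr_sqr.
set C := map_mx _ _.
have [r charC] := closed_field_poly_normal (char_poly C).
have normc0 (z : R[i]) : 0 <= Normc.normc z.
  by case: z => a b; rewrite sqrtr_ge0.
exists (\sum_(z <- r) Normc.normc z) => _ [z /= eigz <-].
have zr : z \in r.
  move: eigz; rewrite eigenvalue_root_char charC.
  by rewrite (monicP (char_poly_monic C)) scale1r root_prod_XsubC.
by rewrite (big_rem z) //= lerDl sumr_ge0.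
Qed.

(** The maximal Rayleigh quotient of [A] is the opposite of the minimal one of
    [- A], hence an eigenvalue of [A]. *)
Lemma rayleigh_le_spectral_radius (R : realType) n (A : 'M[R]_n) :
  A^T = A ->
  forall u : 'cV[R]_n, dotcv (A *m u) u <= spectral_radius A * dotcv u u.
Proof.
move=> symA u; have [n0|n0] := posnP n.
  by subst n; rewrite /dotcv !big_ord0 mulr0.
have [|m eigm mle] := @rayleigh_min_eigenvalue _ _ (- A) n0.
  by rewrite linearN /= symA.
have eigA : eigenvalue A (- m).
  have [v vA v0] := eigenvalueP eigm; apply/eigenvalueP; exists v => //.
  by rewrite scaleNr -vA mulmxN opprK.
have := eigenvalue_le_spectral_radius eigA.
move=> /(le_trans (ler_norm _)) /(ler_wpM2r (dotcv_ge0 u)) le_rho.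
have := mle u; rewrite mulNmx -scaleN1r dotcvZl; lra.
Qed.

(** * Energy decay *)

(** The difference of the two sides, as a function of [y], vanishes at [x], and
    its derivative [f x + L (y - x) - f y] has the sign of [y - x], because [f]
    is [L]-Lipschitz. *)
Lemma primitive_taylor_le (R : realType) (f F : R -> R) (L : R) :
  (forall x : R, derivable f x 1) -> (forall x : R, `|derive1 f x| <= L) ->
  (forall x : R, is_derive x 1 F (f x)) ->
  forall x y, F y - F x <= f x * (y - x) + L / 2 * (y - x) ^+ 2.
Proof.
move=> df dfL dF.
have mvt (g dg : R -> R) a b :
    a <= b -> (forall x : R, is_derive x 1 g (dg x)) ->
    exists2 c : R, a <= c <= b & g b - g a = dg c * (b - a).
  move=> ab dg_.
  have [|c cab ->] := @MVT_segment R g dg a b ab (fun x _ => dg_ x).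
    apply: derivable_within_continuous => x _; exact: ex_derive.
  by exists c => //; move: cab; rewrite in_itv.
have lip a b : a <= b -> `|f b - f a| <= L * (b - a).
  move=> ab; have [|c _ ->] := mvt f (derive1 f) a b ab.
    by move=> x; rewrite derive1E; apply: derivableP.
  rewrite normrM (ger0_norm (_ : 0 <= b - a)) ?subr_ge0 //.
  by rewrite ler_wpM2r ?subr_ge0.
move=> x y.
pose g t := F t - (f x * (t - x) + L / 2 * (t - x) ^+ 2).
pose dg t := f t - (f x + L * (t - x)).
have dg_ (t : R) : is_derive t 1 g (dg t).
  have := dF t => dFt; rewrite /g /dg; apply: is_derive_eq.
  rewrite /GRing.scale /=; lra.
have gx : g x = F x by rewrite /g subrr expr0n /= !mulr0 addr0 subr0.
suff : g y <= g x by rewrite gx /g; lra.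
rewrite -subr_le0; have [xy|/ltW yx] := leP x y.
  have [c /andP[xc cy] ->] := mvt g dg x y xy dg_.
  rewrite mulr_le0_ge0 ?subr_ge0 // /dg.
  have := lip x c xc; rewrite ler_norml; lra.
have [c /andP[yc cx]] := mvt g dg y x yx dg_.
rewrite -opprB => /eqP; rewrite eqr_oppLR => /eqP ->.
rewrite oppr_le0 mulr_ge0 ?subr_ge0 // /dg.
have := lip c x cx; rewrite ler_norml; lra.
Qed.

(** The equation of the step, paired with [d], trades the linear terms
    [<A u, d>] and [<f u, d>] of the variation for [- |d|^2 / dt] and for
    [- tau <B d, d>], which [beta] compares with [<A d, d>]. *)
Lemma implicit_step_energy_le (R : realType) n (A B : 'M[R]_n) (f F : R -> R)
    (L eps tau dt beta : R) (u d : 'cV[R]_n) :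
  A^T = A ->
  (forall v : 'cV[R]_n, dotcv (A *m v) v <= beta * dotcv (B *m v) v) ->
  (forall x y, F y - F x <= f x * (y - x) + L / 2 * (y - x) ^+ 2) ->
  0 < beta -> 0 <= tau -> 0 < dt ->
  (1%:M + (tau * dt) *: B) *m d
    = - dt *: (A *m u + (eps ^+ 2)^-1 *: map_mx f u) ->
  energy A F eps (u + d) - energy A F eps u
  <= (1 / 2 - tau / beta) * dotcv (A *m d) d
     + (L / (2 * eps ^+ 2) - dt^-1) * dotcv d d.
Proof.
move=> symA leAB taylor beta0 tau0 dt0 /(congr1 (fun w => dotcv w d)).
rewrite mulmxDl mul1mx -scalemxAl !(dotcvDl, dotcvZl).
have FD : dotcv (map_mx F (u + d)) (const_mx 1)
          - dotcv (map_mx F u) (const_mx 1)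
          <= dotcv (map_mx f u) d + L / 2 * dotcv d d.
  rewrite /dotcv mulr_sumr -sumrB -big_split; apply: ler_sum => i _.
  have := taylor (u i 0) (u i 0 + d i 0).
  by rewrite !mxE !mulr1 addrAC subrr add0r -expr2.
have eps2 : 0 <= (eps ^+ 2)^-1 by rewrite invr_ge0 sqr_ge0.
have := ler_wpM2l eps2 FD.
have : tau / beta * dotcv (A *m d) d <= tau * dotcv (B *m d) d.
  by rewrite -mulrA ler_wpM2l // ler_pdivrMl.
rewrite /energy mulmxDr !dotcvDl !dotcvDr (dotcv_mulmx_sym d u symA).
rewrite (dotcvC d) (invfM 2 (eps ^+ 2)).
set e2 := (eps ^+ 2)^-1; set a := dotcv (A *m d) d; set b := dotcv (B *m d) d.
set c := dotcv (A *m u) d; set s := dotcv d d; set p := dotcv (map_mx f _) _.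
move=> hB hF hs.
have hs' : dt^-1 * s + tau * b = - (c + e2 * p).
  apply: (mulfI (lt0r_neq0 dt0)); rewrite mulrDr mulrA mulfV ?lt0r_neq0 //.
  by rewrite mul1r mulrN -mulNr -hs mulrCA mulrA.
lra.
Qed.

Lemma stable_of_increment_le0 (R : realType) n (A B : 'M[R]_n) (f F : R -> R)
    (L eps tau dt beta : R) :
  A^T = A ->
  (forall v : 'cV[R]_n, dotcv (A *m v) v <= beta * dotcv (B *m v) v) ->
  C1 f -> (forall x : R, `|derive1 f x| <= L) -> primitive0 f F ->
  0 < beta -> 0 <= tau -> 0 < dt ->
  (forall v : 'cV[R]_n, (1 / 2 - tau / beta) * dotcv (A *m v) v
     + (L / (2 * eps ^+ 2) - dt^-1) * dotcv v v <= 0) ->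
  stable A B f F eps tau dt.
Proof.
move=> symA leAB [df _] dfL [_ dF] beta0 tau0 dt0 le0 u scheme k.
have taylor := primitive_taylor_le df dfL dF.
have := implicit_step_energy_le symA leAB taylor beta0 tau0 dt0 (scheme k).
by move=> /le_trans/(_ (le0 _)); rewrite subr_le0 addrC subrK.
Qed.

(** Holds for every sign of [c]: for [c <= 0] the conclusion is immediate, and
    [c = 0] is the case where the quotient is infinite. *)
Lemma lt_ereal_div (R : realType) (a c dt : R) :
  0 < a -> 0 < dt -> (dt%:E < a%:E / c%:E)%E -> c < a / dt.
Proof.
move=> a0 dt0; rewrite inver; case: eqP => [-> _|/eqP c0].
  exact: divr_gt0.
rewrite -EFinM lte_fin; have [cneg|cpos] := leP c 0.
  by move=> _; apply: (le_lt_trans cneg); exact: divr_gt0.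
by rewrite !ltr_pdivlMr // mulrC.
Qed.

(* The upper bounds on the time step are computed in the extended reals, where
   a / 0 = +oo for a > 0: a vanishing denominator (L = 0 in the last part, or
   L = 0 and spectral_radius A = 0 in part (2)) means that there is no bound. *)
Theorem theorem3p1 (R : realType) (n : nat) (A B : 'M[R]_n) (W : set 'cV[R]_n)
    (alpha beta : R) (f F : R -> R) (L eps tau : R)
    (hA : symmetric_psd A) (hB : symmetric_psd B)
    (hKerA : Ker A = W) (hKerB : Ker B = W)
    (halpha : 0 < alpha) (hbeta : 0 < beta)
    (hAB : forall u : 'cV[R]_n,
       alpha * dotcv (B *m u) u <= dotcv (A *m u) u
       /\ dotcv (A *m u) u <= beta * dotcv (B *m u) u)
    (hf : C1 f) (hL : forall x : R, `|derive1 f x| <= L)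
    (hF : primitive0 f F)
    (heps : 0 < eps) (htau : 0 <= tau) :
  (W = [set 0] ->
    (beta / 2 <= tau ->
      (0 <= (tau / beta - 1 / 2) * lambda_min A - L / (2 * eps ^+ 2) ->
        forall dt : R, 0 < dt -> stable A B f F eps tau dt)
      /\
      ((tau / beta - 1 / 2) * lambda_min A - L / (2 * eps ^+ 2) < 0 ->
        forall dt : R, 0 < dt ->
          (dt%:E < 1 / (L / (2 * eps ^+ 2)
                        - (tau / beta - 1 / 2) * lambda_min A)%R%:E)%E ->
          stable A B f F eps tau dt))
    /\
    (tau < beta / 2 ->
      forall dt : R, 0 < dt ->
        (dt%:E < 1 / (L / (2 * eps ^+ 2)
                      - (tau / beta - 1 / 2) * spectral_radius A)%R%:E)%E ->
        stable A B f F eps tau dt))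
  /\
  (W <> [set 0] ->
    (beta / 2 <= tau ->
      (0 <= (tau / beta - 1 / 2) * lambda_min A - L / (2 * eps ^+ 2) ->
        forall dt : R, 0 < dt -> (dt%:E < (2 * eps ^+ 2)%:E / L%:E)%E ->
          stable A B f F eps tau dt)
      /\
      ((tau / beta - 1 / 2) * lambda_min A - L / (2 * eps ^+ 2) < 0 ->
        forall dt : R, 0 < dt -> (dt%:E < (2 * eps ^+ 2)%:E / L%:E)%E ->
          (dt%:E < 1 / (L / (2 * eps ^+ 2)
                        - (tau / beta - 1 / 2) * lambda_min A)%R%:E)%E ->
          stable A B f F eps tau dt))
    /\
    (tau < beta / 2 ->
      forall dt : R, 0 < dt -> (dt%:E < (2 * eps ^+ 2)%:E / L%:E)%E ->
        (dt%:E < 1 / (L / (2 * eps ^+ 2)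
                      - (tau / beta - 1 / 2) * spectral_radius A)%R%:E)%E ->
        stable A B f F eps tau dt)).
Proof.
have [symA psdA] := hA.
have leAB v := (hAB v).2.
have e2 : 0 < 2 * eps ^+ 2 by rewrite mulr_gt0 ?exprn_gt0.
have stab dt := @stable_of_increment_le0 _ _ _ _ _ _ _ eps _ dt _
  symA leAB hf hL hF hbeta htau.
(* The time step enters the increment of the energy only through [dt^-1]. *)
have inv_dt (c dt : R) : 0 < dt -> (dt%:E < 1 / c%:E)%E -> c < dt^-1.
  by move=> dt0 /(lt_ereal_div ltr01 dt0); rewrite div1r.
have L_dt (dt : R) : 0 < dt -> (dt%:E < (2 * eps ^+ 2)%:E / L%:E)%E ->
    L / (2 * eps ^+ 2) < dt^-1.
  by move=> dt0 /(lt_ereal_div e2 dt0); rewrite ltr_pdivrMr // mulrC.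
have small_tau : tau < beta / 2 -> forall dt : R, 0 < dt ->
    (dt%:E < 1 / (L / (2 * eps ^+ 2)
                  - (tau / beta - 1 / 2) * spectral_radius A)%R%:E)%E ->
    stable A B f F eps tau dt.
  move=> tau_lt dt dt0 /(inv_dt _ _ dt0) lt_dt; apply: stab => // v.
  have t0 : 0 <= 1 / 2 - tau / beta.
    by rewrite subr_ge0 ler_pdivrMr //; lra.
  have := ler_wpM2l t0 (rayleigh_le_spectral_radius symA v).
  have := dotcv_ge0 v; nra.
have large_tau : beta / 2 <= tau -> 0 <= tau / beta - 1 / 2.
  by move=> le_tau; rewrite subr_ge0 ler_pdivlMr //; lra.
split=> kerA.
  split; last exact: small_tau.
  have bound_dt : beta / 2 <= tau -> forall dt, 0 < dt ->
      L / (2 * eps ^+ 2) - (tau / beta - 1 / 2) * lambda_min A < dt^-1 ->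
      stable A B f F eps tau dt.
    move=> /large_tau t0 dt dt0 lt_dt; apply: stab => // v.
    have lemin : lambda_min A * dotcv v v <= dotcv (A *m v) v.
      by apply: lambda_min_le_rayleigh => //; rewrite hKerA.
    have := ler_wpM2l t0 lemin; have := dotcv_ge0 v; nra.
  move=> le_tau; split=> [c0 dt dt0|_ dt dt0 /(inv_dt _ _ dt0)].
    apply: bound_dt => //; apply: (@le_lt_trans _ _ 0); first lra.
    by rewrite invr_gt0.
  exact: bound_dt.
split; last by move=> tau_lt dt dt0 _; exact: small_tau.
have nontrivial : beta / 2 <= tau -> forall dt : R, 0 < dt ->
    (dt%:E < (2 * eps ^+ 2)%:E / L%:E)%E -> stable A B f F eps tau dt.
  move=> /large_tau t0 dt dt0 /(L_dt _ dt0) lt_dt; apply: stab => // v.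
  have := mulr_ge0 t0 (psdA v); have := dotcv_ge0 v; nra.
by move=> le_tau; split=> _ dt dt0 lt_dt *; exact: nontrivial.
Qed.
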